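(* Let $X$ be a non-empty set. A binary relation $R$ on $X$ has a semiorder extension if and only if $R$ is acyclic.
   Context: For a binary relation $R$ on a set $X$, the asymmetric part is $P(R)=\{(x,y)\in X\times X : (x,y)\in R \text{ and } (y,x)\notin R\}$. The transitive closure $\overline{R}$ is defined by: $(x,y)\in\overline{R}$ iff there exist $m\geq 1$ and $z_0,\dots,z_m\in X$ with $x=z_0$, $z_m=y$ and $(z_k,z_{k+1})\in R$ for all $0\le k\le m-1$. An $R$-cycle is a non-empty subset $Y\subseteq X$ such that $(x,y)\in\overline{R}$ and $(y,x)\in\overline{R}$ for all $x,y\in Y$; $R$ is acyclic if there is no $R$-cycle. A relation $R^*$ on $X$ is an extension of $R$ if $R\subseteq R^*$ and $P(R)\subseteq P(R^* )$. An interval order is an irreflexive and transitive relation $R$ satisfying the Russell-Wiener axiom: for all $x,y,z,w\in X$, $(x,y)\in R$, $(z,y)\notin R$ and $(z,w)\in R$ imply $(x,w)\in R$. A semitransitive order is an irreflexive relation $R$ such that for all $x,y,z,w\in X$, $(x,y)\in R$ and $(y,z)\in R$ imply $(x,w)\in R$ or $(w,z)\in R$. A semiorder is an interval order which is also a semitransitive order. *)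

(* Defs.v *)
From Stdlib Require Import Relations RelationClasses Lia PeanoNat.

Set Implicit Arguments.

Definition asym_part (X : Type) (R : relation X) : relation X :=
  fun x y => R x y /\ ~ R y x.

(** The transitive closure is [clos_trans], that is, reachability by a chain
    of at least one step. *)
Lemma clos_trans_chain (X : Type) (R : relation X) (x y : X) :
  clos_trans X R x y <->
  exists (m : nat) (z : nat -> X),
    1 <= m /\ x = z 0 /\ z m = y /\ forall k, k <= m - 1 -> R (z k) (z (S k)).
Proof.
split.
- intros H; apply clos_trans_t1n in H.
  induction H as [x y Hxy | x y t Hxy _ (m & z & Hm & -> & <- & Hz)].
  + exists 1, (fun k => match k with 0 => x | _ => y end).
    repeat split; trivial.
    intros k Hk; assert (k = 0) as -> by lia; exact Hxy.
  + exists (S m), (fun k => match k with 0 => x | S j => z j end).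
    repeat split; [lia |].
    intros [| k] Hk; [exact Hxy | apply Hz; lia].
- intros (m & z & Hm & -> & <- & Hz).
  induction m as [| m IH]; [lia |].
  destruct (Nat.eq_dec m 0) as [-> | Hm0].
  + apply t_step, Hz; lia.
  + apply t_trans with (z m).
    * apply IH; [lia |]; intros k Hk; apply Hz; lia.
    * apply t_step, Hz; lia.
Qed.

(** A subset of [X] is a predicate on [X]. *)
Definition is_cycle (X : Type) (R : relation X) (Y : X -> Prop) : Prop :=
  (exists x, Y x) /\
  forall x y, Y x -> Y y -> clos_trans X R x y /\ clos_trans X R y x.

Definition acyclic (X : Type) (R : relation X) : Prop :=
  ~ exists Y : X -> Prop, is_cycle R Y.

Definition is_extension (X : Type) (R Rs : relation X) : Prop :=
  inclusion X R Rs /\ inclusion X (asym_part R) (asym_part Rs).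

Definition russell_wiener (X : Type) (R : relation X) : Prop :=
  forall x y z w : X, R x y -> ~ R z y -> R z w -> R x w.

Definition interval_order (X : Type) (R : relation X) : Prop :=
  Irreflexive R /\ Transitive R /\ russell_wiener R.

Definition semitransitive_order (X : Type) (R : relation X) : Prop :=
  Irreflexive R /\
  forall x y z w : X, R x y -> R y z -> R x w \/ R w z.

Definition semiorder (X : Type) (R : relation X) : Prop :=
  interval_order R /\ semitransitive_order R.

(* Main.v *)
Require Import Defs.
From Stdlib Require Import Relations.
From Stdlib Require Import RelationClasses.
From mathcomp Require Import ssreflect ssrfun ssrbool boolp classical_sets.

(** If [R] has a semiorder extension, that extension is in particular a strict
    partial order containing [R], hence containing the transitive closure of
    [R]; a cycle of [R] would then violate irreflexivity.

    Conversely, acyclicity says exactly that the transitive closure of [R] is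
    irreflexive, i.e. a strict partial order. By Szpilrajn's theorem
    ([szpilrajn]) it is contained in a strict linear order. A strict linear
    order is the simplest kind of semiorder ([linear_semiorder]), and because
    it is asymmetric, containing [R] already makes it an extension of [R]: an
    extension can only fail by adding the converse of a pair of [R].

    Szpilrajn's theorem is obtained from Zorn's lemma: in a maximal strict
    partial order any two distinct points are comparable, since otherwise the
    order could be enlarged by [add_pair]. *)

(** [R] enlarged by the pair [(a, b)] and by all pairs that transitivity then
    forces; the formula is already closed under transitivity when [R] is. *)
Definition add_pair {X : Type} (R : relation X) (a b : X) : relation X :=
  fun u v => R u v \/ ((u = a \/ R u a) /\ (v = b \/ R b v)).

Lemma add_pair_transitive (X : Type) (R : relation X) (a b : X) :
  Transitive R -> Transitive (add_pair R a b).
Proof.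
move=> trR u v w [Ruv|[ua vb]] [Rvw|[va wb]].
- by left; apply: trR Ruv Rvw.
- right; split=> //; right.
  by case: va => [<-|Rva] //; apply: trR Ruv Rva.
- right; split=> //; right.
  by case: vb => [<-|Rbv] //; apply: trR Rbv Rvw.
- by right.
Qed.

(** A loop through the new pair would be a chain of [R] from [b] back to [a]. *)
Lemma add_pair_irreflexive (X : Type) (R : relation X) (a b : X) :
  Irreflexive R -> Transitive R -> a <> b -> ~ R b a ->
  Irreflexive (add_pair R a b).
Proof.
move=> irR trR neq_ab nRba u [Ruu|[ua ub]]; first exact: irR Ruu.
case: ua ub => [->|Rua] [ub|Rbu] //.
- by apply: nRba; rewrite -ub.
- by apply: nRba; apply: trR Rbu Rua.
Qed.

(** Irreflexivity and transitivity each involve at most two pairs, and two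
    pairs of a union of a chain already lie in one member of the chain. *)
Lemma chain_union_strict_order (X : Type) (F : set (relation X)) :
  (forall S, F S -> StrictOrder S) -> total_on F (@inclusion X) ->
  StrictOrder (fun x y => exists2 S, F S & S x y).
Proof.
move=> ordF totF; split.
- by move=> x [S /ordF [irS _]]; exact: irS.
- move=> x y z [S FS Sxy] [T FT Tyz].
  have [ST|TS] := totF _ _ FS FT.
  + have [_ trT] := ordF _ FT.
    by exists T => //; exact: trT (ST _ _ Sxy) Tyz.
  + have [_ trS] := ordF _ FS.
    by exists S => //; exact: trS Sxy (TS _ _ Tyz).
Qed.

Lemma maximal_strict_order_linear (X : Type) (S : relation X) :
  StrictOrder S ->
  (forall T, StrictOrder T -> inclusion X S T -> inclusion X T S) ->
  forall x y, x <> y -> S x y \/ S y x.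
Proof.
move=> [irS trS] maxS x y neq_xy.
have [Syx|nSyx] := pselect (S y x); first by right.
left; apply: (maxS (add_pair S x y)).
- split; first exact: add_pair_irreflexive.
  exact: add_pair_transitive.
- by move=> u v; left.
- by right; split; left.
Qed.

(** Zorn's lemma is applied to the strict partial orders that contain [R], so
    that a maximal one is automatically an extension. They are compared by
    inclusion of the underlying relations, which is only a preorder on the
    subtype as long as proofs are not identified; premaximality is enough. *)
Lemma szpilrajn {X : Type} {R : relation X} :
  StrictOrder R ->
  exists L : relation X,
    [/\ inclusion X R L, StrictOrder L & forall x y, x <> y -> L x y \/ L y x].
Proof.
move=> ordR.
pose ord := {S : relation X | StrictOrder S /\ inclusion X R S}.
pose mk (S : relation X) (oS : StrictOrder S) (RS : inclusion X R S) : ord :=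
  exist _ S (conj oS RS).
have RR : inclusion X R R by [].
pose R0 := mk R ordR RR.
pose le (S T : ord) := `[< inclusion X (sval S) (sval T) >].
have [|||[S [ordS RS]] maxS] := @ZL_preorder ord R0 le.
- by move=> S; apply/asboolP.
- move=> S T U /asboolP ST /asboolP TU; apply/asboolP => x y Sxy.
  exact/TU/ST.
- move=> A totA.
  (* The union of the empty chain need not contain R; R itself is then a bound. *)
  have [[S0 AS0]|A0] := pselect (exists S, A S); last first.
    by exists R0 => S AS; case: A0; exists S.
  pose F : set (relation X) := fun S => exists2 T, A T & sval T = S.
  have ordU : StrictOrder (fun x y => exists2 S, F S & S x y).
    apply: chain_union_strict_order.
      by move=> _ [T _ <-]; exact: (proj1 (svalP T)).
    move=> _ _ [T AT <-] [T' AT' <-].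
    by have [/asboolP|/asboolP] := totA _ _ AT AT'; [left|right].
  have RU : inclusion X R (fun x y => exists2 S, F S & S x y).
    move=> x y Rxy; exists (sval S0); first by exists S0.
    exact: (proj2 (svalP S0)).
  exists (mk _ ordU RU) => S AS; apply/asboolP => x y Sxy.
  by exists (sval S) => //; exists S.
- exists S; split=> //; apply: maximal_strict_order_linear => // T ordT ST.
  have RT : inclusion X R T by move=> x y Rxy; exact/ST/RS.
  exact/asboolP/(maxS (mk T ordT RT))/asboolP.
Qed.

(** Each axiom is settled by placing one point in the line: if [z] is not
    below [y] then [x] is below [y], [y] at most [z], and [z] below [w]; and if
    [y] lies between [x] and [z], then any [w] is either at most [y], hence
    below [z], or above [y], hence above [x]. *)
Lemma linear_semiorder (X : Type) (L : relation X) :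
  StrictOrder L -> (forall x y, x <> y -> L x y \/ L y x) -> semiorder L.
Proof.
move=> [irL trL] totL; split; last split=> //.
- split=> //; split=> // x y z w Lxy nLzy Lzw.
  have [yz|/totL [Lyz|//]] := pselect (y = z).
  + by rewrite -yz in Lzw; exact: trL Lxy Lzw.
  + exact: trL (trL _ _ _ Lxy Lyz) Lzw.
- move=> x y z w Lxy Lyz.
  have [->|/totL [Lwy|Lyw]] := pselect (w = y); first by right.
  + by right; exact: trL Lwy Lyz.
  + by left; exact: trL Lxy Lyw.
Qed.

Lemma strict_order_extension (X : Type) (R S : relation X) :
  StrictOrder S -> inclusion X R S -> is_extension R S.
Proof.
move=> [irS trS] RS; split=> // x y [Rxy _].
split; first exact: RS.
by move=> Syx; apply: (irS x); exact: trS (RS _ _ Rxy) Syx.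
Qed.

Lemma clos_trans_minimal {X : Type} {R S : relation X} :
  Transitive S -> inclusion X R S -> inclusion X (clos_trans X R) S.
Proof.
move=> trS RS x y; elim=> [u v /RS //|u v w _ Suv _ Svw].
exact: trS Suv Svw.
Qed.

(** A point of a cycle is reachable from itself, and conversely such a point
    is a one-element cycle. *)
Lemma acyclic_strict_order (X : Type) (R : relation X) :
  acyclic R <-> StrictOrder (clos_trans X R).
Proof.
split.
- move=> acR; split; last by move=> x y z; exact: t_trans.
  move=> x Rxx; apply: acR; exists (eq x); split; first by exists x.
  by move=> u v <- <-.
- move=> [irR _] [Y [[x Yx] cycY]].
  exact: irR (proj1 (cycY x x Yx Yx)).
Qed.

Theorem theorem3p8 (X : Type) (hX : inhabited X) (R : relation X) :
  (exists Rs : relation X, is_extension R Rs /\ semiorder Rs) <-> acyclic R.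
Proof.
rewrite acyclic_strict_order; split.
- move=> [S [[RS _] [[irS [trS _]] _]]].
  split; last by move=> x y z; exact: t_trans.
  by move=> x /(clos_trans_minimal trS RS); exact: irS.
- move=> /szpilrajn [L [RL ordL totL]].
  exists L; split; last exact: linear_semiorder.
  by apply: strict_order_extension => // x y Rxy; apply: RL; exact: t_step.
Qed.
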